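(* Let $r,z\ge 1$ and $k\ge 2$ be integers. If $G$ is an $(r,z,k;+1)$-graph, then $k=2$ and $G$ is totally regular.
   Context: A (finite) mixed graph $G$ consists of a vertex set $V(G)$, a set of undirected edges and a set of directed arcs (ordered pairs of vertices). Loops are forbidden, as are parallel edges and arcs. Write $u\sim v$ if there is an edge between $u$ and $v$, and $u\to v$ if there is an arc from $u$ to $v$. The undirected degree $d(u)$ is the number of edges incident with $u$; the directed out-degree $d^+(u)$ (in-degree $d^-(u)$) is the number of arcs with initial (terminal) vertex $u$. $G$ is totally regular if there are $r,z$ with $d(u)=r$ and $d^+(u)=d^-(u)=z$ for all vertices $u$. A walk of length $\ell$ from $u_0$ to $u_\ell$ is a sequence $u_0u_1\dots u_\ell$ of vertices such that for each $0\le i\le \ell-1$ either $u_i\sim u_{i+1}$ or $u_i\to u_{i+1}$. A mixed path is a non-backtracking walk, i.e. a walk that never traverses an edge and then immediately retraces it (no $u_i\sim u_{i+1}\sim u_i$); walks of length $0$ are allowed. $G$ is $k$-geodetic if for every ordered pair $(u,v)$ of (not necessarily distinct) vertices there is at most one mixed path from $u$ to $v$ of length $\le k$. The mixed Moore bound $M(r,z,k)$ is the number of vertices of the mixed Moore tree of depth $k$: $M(r,z,k)=1+\sum_{t=1}^{k}(E_t+D_t)$, where $E_1=r$, $D_1=z$, $E_{t+1}=(r-1)E_t+rD_t$ and $D_{t+1}=z(E_t+D_t)$. An $(r,z,k;+\epsilon)$-graph is a $k$-geodetic mixed graph with minimum undirected degree $r$, minimum directed out-degree $z$ and order $M(r,z,k)+\epsilon$;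 $\epsilon$ is its excess. *)

(* Defs.v *)
From mathcomp Require Import all_boot.

Set Implicit Arguments.
Unset Strict Implicit.
Unset Printing Implicit Defensive.

(* An edge may not be parallel to an arc in either direction (the reverse
   direction follows from [edge_sym]).  A pair of opposite arcs is not parallel
   and is allowed here. *)
Record mixed_graph := MixedGraph {
  vertex :> finType;
  edge : rel vertex;
  arc : rel vertex;
  edge_sym : symmetric edge;
  edge_irr : irreflexive edge;
  arc_irr : irreflexive arc;
  edge_arc_disjoint : forall u v : vertex, edge u v -> ~~ arc u v
}.

Definition udeg (G : mixed_graph) (u : G) : nat := #|[set v : G | edge u v]|.
Definition outdeg (G : mixed_graph) (u : G) : nat := #|[set v : G | arc u v]|.
Definition indeg (G : mixed_graph) (u : G) : nat := #|[set v : G | arc v u]|.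

Definition totally_regular (G : mixed_graph) : Prop :=
  exists r z : nat,
    forall u : G, [/\ udeg u = r, outdeg u = z & indeg u = z].

Definition adj (G : mixed_graph) : rel G := fun u v => edge u v || arc u v.

Definition nonbacktracking (G : mixed_graph) (s : seq G) : Prop :=
  forall u v : G, edge u v -> ~~ infix [:: u; v; u] s.

(* The walk u_0 u_1 ... u_l is given by its initial vertex u = u_0 and the
   sequence p = [:: u_1; ...; u_l]; its length is [size p].  As edges and arcs
   are never parallel, the vertex sequence determines which edges and arcs are
   traversed. *)
Definition mixed_path (G : mixed_graph) (u v : G) (p : seq G) : Prop :=
  [/\ path (@adj G) u p, last u p = v & nonbacktracking (u :: p)].

Definition geodetic (G : mixed_graph) (k : nat) : Prop :=
  forall (u v : G) (p q : seq G),
    size p <= k -> size q <= k ->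
    mixed_path u v p -> mixed_path u v q -> p = q.

(* [moore_level r z t] is the pair (E_(t+1), D_(t+1)) of the numbers of
   vertices at depth t+1 of the mixed Moore tree that are reached from their
   parent by an edge, respectively by an arc.  For r = 0 every E_t is 0, so the
   truncation of r - 1 is harmless. *)
Fixpoint moore_level (r z t : nat) : nat * nat :=
  if t is t'.+1 then
    let: (E, D) := moore_level r z t' in ((r - 1) * E + r * D, z * (E + D))
  else (r, z).

Definition moore_bound (r z k : nat) : nat :=
  1 + \sum_(t < k) ((moore_level r z t).1 + (moore_level r z t).2).

Definition is_minimum (T : finType) (f : T -> nat) (m : nat) : Prop :=
  (forall x : T, m <= f x) /\ (exists x : T, f x = m).

(* [G] is an (r,z,k;+eps)-graph: r and z are the exact (attained) minima. *)
Definition excess_graph (r z k eps : nat) (G : mixed_graph) : Prop :=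
  [/\ geodetic G k,
      is_minimum (@udeg G) r,
      is_minimum (@outdeg G) z &
      #|G| = moore_bound r z k + eps].

(* Main.v *)
From mathcomp Require Import all_boot zify.
Require Import Defs.

(** Write [d = r + z], and let the out-neighbours of a vertex be the vertices
reached from it along one edge or one arc. Counting the mixed paths of length
at most [k] from a vertex level by level shows that a vertex of degree larger
than the minimum would force two vertices above the Moore bound. So all
undirected degrees are [r], all out-degrees are [z], and every vertex [u]
fails to reach exactly one vertex within [k] steps, its outlier [o u].

Everything then rests on one identity, [balance]. Fix [u] and [v], and compare
the walks that consist of a first step out of [u] followed by a mixed path of
length at most [k] to [v] with the walks that consist of a mixed path of length
at most [k] from [u] followed by a last step into [v]. There are
[r + z - h] walks of the first kind, where [h] is the number of out-neighbours
of [u] whose outlier is [v], and [r + indeg v - e] of the second kind, where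
[e] is 1 or 0 according to whether [v] is an out-neighbour of [o u]. A walk of
only one kind backtracks at one of its ends, and removing the backtracking
leaves a path from [u] to [v] of length between 1 and [k - 1]; there is at most
one such path. Hence [z + e = indeg v + h], up to a correction of 1 when that
path begins with an edge and ends with an arc, or the reverse. In matrix terms
this is the commutator of the adjacency matrix with the matrix of short paths.
In particular no in-degree exceeds [z + 1].

If [k >= 3], the correction is really present. First, the paths formed by an
arc and then an edge, or by an edge and then an arc, exclude in-degree [z + 1]
([indeg_le]); as the in-degrees add up to the out-degrees, they are all [z].
Next, if there is an arc from [u] to [x], the edge-neighbours of [x] are
out-neighbours of [o u]; two of them would give two paths of length 2 from
[o u] to [x]. So [r = 1], the edges form a perfect matching [mate], and the
heads of the arcs out of [o u] are the mates of the heads of the arcs out of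
[u]. For [k >= 4] this already produces a repeated path ([k_eq3]). For [k = 3]
the map [o] also commutes with [mate] and sends the heads of the arcs out of
[u] to heads of arcs out of [mate u]; following the path from [u] to
[mate (o u)] with these rules leads to a closed path of length 3
([geodecity3_impossible]).

If [k = 2], a path of length 1 starts and ends with the same step and the
correction vanishes. Suppose that some vertex has in-degree [z + 1]. Such
vertices are out-neighbours of every outlier and are missed by nobody. Counting
the paths into one of them ([in_count]) shows that there are at least [d] of
them, so they are exactly the [d] out-neighbours of each outlier
([outlier_nbrs]). Then all outliers have in-degree below [z], the total deficit
of these in-degrees is [d], and counting the paths into them bounds the number
of pairs [(u, o u)], which is the order of the graph, by less than that order
([no_surplus2]). *)

Set Implicit Arguments.
Unset Strict Implicit.
Unset Printing Implicit Defensive.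

(** * Non-backtracking walks *)

Section Walks.
Variable G : mixed_graph.
Implicit Types (u v w x y : G) (p q s : seq G).

Fixpoint nonback s : bool :=
  if s is x :: s1 then
    (if s1 is y :: z :: _ then ~~ (edge x y && (z == x)) else true) && nonback s1
  else true.

Lemma nonbackP s : reflect (nonbacktracking s) (nonback s).
Proof.
apply: (iffP idP) => [nb_s u v euv | nb_s].
  apply/negP => /infixP[s1 [s2 def_s]]; move: nb_s; rewrite def_s /=.
  elim: s1 {def_s} => [|x s1 IHs] /=; first by rewrite euv eqxx.
  by case/andP.
elim: s nb_s => // x s1 IHs nb_s /=; apply/andP; split; last first.
  apply: IHs => u v euv; apply: contra (nb_s u v euv) => /infixP[s2 [s3 ->]].
  by apply/infixP; exists (x :: s2), s3.
case: s1 nb_s {IHs} => [|y [|z s1]] // nb_s; apply/negP => /andP[exy /eqP def_z].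
by have /negP[] := nb_s x y exy; apply/infixP; exists [::], s1; rewrite def_z.
Qed.

(** The last vertex but one of the walk [u :: p], with [u] itself as the default
value when [p] is empty. Because edges are irreflexive, [ends_edge u [::]] is
then false. *)
Definition penult u p := last u (belast u p).

Definition ends_edge u p := edge (penult u p) (last u p).

Definition starts_edge u p := if p is w :: _ then edge u w else false.

Lemma nonback_rcons u p x :
  nonback (u :: rcons p x) =
  nonback (u :: p) && ~~ (ends_edge u p && (penult u p == x)).
Proof.
elim: p u => [|y p IHp] u.
  by rewrite /ends_edge /penult /= edge_irr.
case: p IHp => [|z p] IHp; last first.
  rewrite [LHS](_ : _ =
    ~~ (edge u y && (z == u)) && nonback (y :: rcons (z :: p) x)) //.
  by rewrite IHp [nonback (u :: _)]/= -!andbA.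
by rewrite /ends_edge /penult /= !andbT eq_sym.
Qed.

(** The boolean form of [mixed_path], with the end vertex left implicit. *)
Definition mpath u p := path (@adj G) u p && nonback (u :: p).

Lemma mpathP u p : reflect (mixed_path u (last u p) p) (mpath u p).
Proof.
apply: (iffP andP) => [[pth /nonbackP nb_p] | [pth _ /nonbackP]]; first by split.
by split.
Qed.

Lemma mpath_rcons u p x :
  mpath u (rcons p x) =
  [&& mpath u p, adj (last u p) x & ~~ (ends_edge u p && (penult u p == x))].
Proof.
rewrite /mpath rcons_path nonback_rcons; case: path; case: (nonback _) => //.
by rewrite /= andbF.
Qed.

Lemma mpath_cons u x p :
  mpath u (x :: p) =
  [&& adj u x, mpath x p & if p is y :: _ then ~~ (edge u x && (y == u)) else true].
Proof.
by rewrite /mpath /=; case: p => [|y p]; rewrite ?andbT //= -!andbA; do !bool_congr.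
Qed.

Lemma adj_irr u : adj u u = false.
Proof. by rewrite /adj edge_irr arc_irr. Qed.

Lemma edge_adj u v : edge u v -> adj u v. Proof. by rewrite /adj => ->. Qed.
Lemma arc_adj u v : arc u v -> adj u v. Proof. by rewrite /adj orbC => ->. Qed.

Lemma edge_arcF u v : edge u v -> arc u v = false.
Proof. by move/edge_arc_disjoint/negbTE. Qed.
Lemma edge_arcF' u v : edge u v -> arc v u = false.
Proof. by rewrite edge_sym => /edge_arcF. Qed.
Lemma arc_edgeF u v : arc u v -> edge u v = false.
Proof. by move=> auv; apply: contraTF auv => /edge_arc_disjoint. Qed.
Lemma arc_edgeF' u v : arc u v -> edge v u = false.
Proof. by rewrite edge_sym => /arc_edgeF. Qed.

(** Edges and arcs are never parallel, so edge- and arc-neighbours are disjoint. *)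
Lemma card_adj u : #|[set x | adj u x]| = udeg u + outdeg u.
Proof.
rewrite /udeg /outdeg -cardsUI [X in _ + X]eq_card0 ?addn0; last first.
  by move=> x; rewrite !inE; case e: (edge u x); rewrite // (edge_arcF e).
by apply: eq_card => x; rewrite !inE.
Qed.

Lemma card_adj_in v : #|[set x | adj x v]| = udeg v + indeg v.
Proof.
rewrite /udeg /indeg -cardsUI [X in _ + X]eq_card0 ?addn0; last first.
  by move=> x; rewrite !inE; case e: (edge v x); rewrite // (edge_arcF' e).
by apply: eq_card => x; rewrite !inE edge_sym.
Qed.

End Walks.

(** * Counting mixed paths by length *)

Section Counting.
Variable G : mixed_graph.
Implicit Types (u v w x y : G) (p q s : seq G).

Definition step u p x :=
  adj (last u p) x && ~~ (ends_edge u p && (penult u p == x)).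

(** When the path arrives along an edge, exactly one edge is forbidden as the
next step: the one just traversed. *)
Lemma card_edge_steps u p :
  #|[set x | step u p x && edge (last u p) x]| + ends_edge u p
  = udeg (last u p).
Proof.
rewrite /udeg /step; case: (boolP (ends_edge u p)) => [e | _] /=; last first.
  rewrite addn0; apply: eq_card => x; rewrite !inE andbT.
  by apply/andb_idl => /edge_adj.
rewrite [RHS](cardsD1 (penult u p)) inE edge_sym [edge _ _]e addnC.
congr addn; apply: eq_card => x; rewrite !inE [x == _]eq_sym.
case: eqP => [<- | _] /=; rewrite ?andbF ?andbT //.
by apply/andb_idl => /edge_adj.
Qed.

(** Every arc is a legal next step: it cannot lead back along the edge just
traversed, since that edge would be parallel to it. *)
Lemma card_arc_steps u p :
  #|[set x | step u p x && ~~ edge (last u p) x]| = outdeg (last u p).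
Proof.
apply: eq_card => x; rewrite !inE /step /adj.
case e: (edge _ x); first by rewrite andbF (edge_arcF e).
rewrite /= andbT; apply/andb_idr => a; apply/negP => /andP[e' /eqP def_x].
by move: e'; rewrite /ends_edge def_x (arc_edgeF' a).
Qed.

Definition extensions u p := [seq rcons p x | x <- enum (step u p)].

Definition paths u t :=
  iter t (fun L => flatten [seq extensions u p | p <- L]) [:: [::]].

Lemma mem_paths u t p : (p \in paths u t) = mpath u p && (size p == t).
Proof.
elim: t p => [|t IHt] p; first by case: p => // x p; rewrite andbF.
apply/flatten_mapP/idP => [[q] | ].
  rewrite IHt => /andP[mp_q /eqP sz_q] /mapP[x].
  rewrite mem_enum => stp ->; rewrite mpath_rcons mp_q size_rcons sz_q eqxx andbT.
  exact: stp.
case/lastP: p => [|q x]; first by rewrite andbF.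
rewrite mpath_rcons size_rcons eqSS => /andP[/andP[mp_q stp] sz_q].
exists q; first by rewrite IHt mp_q.
by apply/mapP; exists x; rewrite // mem_enum.
Qed.

Lemma uniq_paths u t : uniq (paths u t).
Proof.
elim: t => //= t; elim: (paths u t) => //= p L IHL /andP[p_notin uniqL].
rewrite cat_uniq IHL // andbT map_inj_uniq ?enum_uniq; last first.
  by move=> x y /rcons_inj[].
apply/hasPn => _ /flatten_mapP[q q_in /mapP[x _ ->]].
apply/negP => /mapP[y _ /rcons_inj[def_p _]].
by rewrite -def_p q_in in p_notin.
Qed.

Definition edge_level u t := count (ends_edge u) (paths u t).
Definition arc_level u t := count (predC (ends_edge u)) (paths u t).

Lemma size_paths u t : size (paths u t) = edge_level u t + arc_level u t.
Proof. by rewrite count_predC. Qed.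

Lemma count_extensions (a : pred (seq G)) u t :
  count a (paths u t.+1)
  = \sum_(p <- paths u t) #|[set x | step u p x && a (rcons p x)]|.
Proof.
rewrite /paths iterS count_flatten sumnE !big_map; apply: eq_bigr => p _.
rewrite /extensions count_map cardE -size_filter; apply/perm_size.
apply: uniq_perm => [||x]; [exact/filter_uniq/enum_uniq|exact: enum_uniq|].
by rewrite mem_filter !mem_enum !inE andbC.
Qed.

Lemma ends_edge_rcons u p x : ends_edge u (rcons p x) = edge (last u p) x.
Proof. by rewrite /ends_edge /penult belast_rcons last_rcons. Qed.

Lemma penult_rcons u p x : penult u (rcons p x) = last u p.
Proof. by rewrite /penult belast_rcons. Qed.

(** This and [arc_levelS] are the recurrence of the Moore tree, with the actual
degrees in place of [r] and [z]. *)
Lemma edge_levelS u t :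
  edge_level u t.+1 + edge_level u t = \sum_(p <- paths u t) udeg (last u p).
Proof.
rewrite /edge_level count_extensions -sum1_count [X in _ + X]big_mkcond.
rewrite -big_split; apply: eq_bigr => p _ /=; rewrite -card_edge_steps.
congr (_ + _).
by apply: eq_card => x; rewrite !inE ends_edge_rcons.
Qed.

Lemma arc_levelS u t :
  arc_level u t.+1 = \sum_(p <- paths u t) outdeg (last u p).
Proof.
rewrite {1}/arc_level count_extensions; apply: eq_bigr => p _ /=.
rewrite -card_arc_steps; apply: eq_card => x.
by rewrite !inE /= ends_edge_rcons.
Qed.

Lemma edge_level1 u : edge_level u 1 = udeg u.
Proof.
have := edge_levelS u 0; rewrite big_seq1 => <-.
rewrite [edge_level u 0](_ : _ = 0) ?addn0 //.
by rewrite /edge_level /= /ends_edge /penult /= edge_irr.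
Qed.

Lemma arc_level1 u : arc_level u 1 = outdeg u.
Proof. by rewrite arc_levelS big_seq1. Qed.

Lemma sum_paths_ge (f : G -> nat) m u t :
  (forall x, m <= f x) ->
  m * (edge_level u t + arc_level u t) <= \sum_(p <- paths u t) f (last u p).
Proof.
move=> f_ge; rewrite -size_paths mulnC -sum1_size big_distrl /=.
by apply: leq_sum => p _; rewrite mul1n.
Qed.

(** Here [t] is shifted by one because [moore_level] starts at depth 1. *)
Lemma moore_level_le r z u t :
  (forall x : G, r <= udeg x) -> (forall x : G, z <= outdeg x) ->
  (moore_level r z t).1 <= edge_level u t.+1 /\
  (moore_level r z t).2 <= arc_level u t.+1.
Proof.
move=> ge_r ge_z; elim: t => [|t [IHe IHa]].
  by rewrite edge_level1 arc_level1 ge_r ge_z.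
have := sum_paths_ge u t.+1 ge_r; rewrite -edge_levelS.
have := sum_paths_ge u t.+1 ge_z; rewrite -arc_levelS /=.
move: IHe IHa; case: (moore_level r z t) => [E D] /= IHe IHa.
case: r ge_r => [|r] ge_r; nia.
Qed.

Lemma moore_level_eq r z u t :
  (forall x : G, udeg x = r) -> (forall x : G, outdeg x = z) ->
  moore_level r z t = (edge_level u t.+1, arc_level u t.+1).
Proof.
move=> eq_r eq_z; elim: t => [|t IHt].
  by rewrite edge_level1 arc_level1 eq_r eq_z.
have := edge_levelS u t.+1; have := arc_levelS u t.+1.
under eq_bigr do rewrite eq_z; under [in X in _ -> X -> _]eq_bigr do rewrite eq_r.
rewrite !big_const_seq !count_predT !size_paths !iter_addn_0 /= IHt => -> eqE.
rewrite mulnC; congr pair.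
have := leq_addl (edge_level u t.+2) (edge_level u t.+1).
rewrite eqE; case: r {eq_r IHt} eqE => [|r]; nia.
Qed.

End Counting.

(** * Short mixed paths and the vertices that they miss *)

Section Reach.
Variables (G : mixed_graph) (k : nat).
Implicit Types (u v w x y : G) (p q s : seq G).

Definition short_paths u := flatten [seq paths u t | t <- iota 0 k.+1].

Lemma mem_short_paths u p : (p \in short_paths u) = mpath u p && (size p <= k).
Proof.
apply/flatten_mapP/andP => [[t] | [mp_p le_p]].
  by rewrite mem_iota mem_paths => lt_t /andP[mp_p /eqP->].
by exists (size p); rewrite ?mem_iota // mem_paths mp_p /=.
Qed.

Lemma uniq_short_paths u : uniq (short_paths u).
Proof.
rewrite /short_paths; elim: (iota 0 k.+1) (iota_uniq 0 k.+1) => //= t ts IHts.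
case/andP=> t_notin /IHts uniq_ts; rewrite cat_uniq uniq_paths uniq_ts andbT.
apply/hasPn => p /flatten_mapP[t' t'_in]; rewrite mem_paths.
case/andP=> _ /eqP sz_p; rewrite [p \in _]mem_paths; apply/negP.
by case/andP=> _; rewrite sz_p => /eqP def_t; rewrite -def_t t'_in in t_notin.
Qed.

Definition reach u v := v \in [seq last u p | p <- short_paths u].

Lemma reachP u v :
  reflect (exists p, [/\ mpath u p, last u p = v & size p <= k]) (reach u v).
Proof.
apply: (iffP mapP) => [[p] | [p [mp_p <- le_p]]].
  by rewrite mem_short_paths => /andP[mp_p le_p] ->; exists p.
by exists p; rewrite // mem_short_paths mp_p.
Qed.

Lemma size_short_paths u :
  size (short_paths u)
  = 1 + \sum_(t < k) (edge_level u t.+1 + arc_level u t.+1).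
Proof.
rewrite /short_paths size_flatten /shape -map_comp sumnE big_map.
rewrite -[iota 0 k.+1]/(index_iota 0 k.+1).
rewrite big_mkord big_ord_recl; congr (_ + _).
by apply: eq_bigr => t _; apply: size_paths.
Qed.

Hypothesis geoG : geodetic G k.

Lemma short_path_uniq u p q :
  mpath u p -> mpath u q -> last u p = last u q -> size p <= k -> size q <= k -> p = q.
Proof.
move=> /mpathP pth_p /mpathP pth_q eq_last le_p le_q.
by apply: (geoG le_p le_q pth_p); rewrite eq_last.
Qed.

(** Geodecity makes distinct short paths end at distinct vertices. *)
Lemma card_reach u : #|reach u| = size (short_paths u).
Proof.
rewrite -(size_map (last u)); apply/card_uniqP.
rewrite map_inj_in_uniq ?uniq_short_paths // => p q.
rewrite !mem_short_paths => /andP[mp_p le_p] /andP[mp_q le_q] eq_last.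
exact: short_path_uniq mp_p mp_q eq_last le_p le_q.
Qed.

Section Excess.
Variables r z : nat.
Hypotheses (r_gt0 : 0 < r) (z_gt0 : 0 < z) (k_gt1 : 1 < k).
Hypotheses (ge_r : forall x : G, r <= udeg x) (ge_z : forall x : G, z <= outdeg x).

(** One extra edge or arc at [u] adds a vertex at depth 1 and, as [k >= 2] and
[r + z >= 2], at least one more at depth 2. Two extra vertices are more than
the excess allows. *)
Lemma excess1_degrees u :
  #|G| = moore_bound r z k + 1 -> udeg u = r /\ outdeg u = z.
Proof.
move=> cardG; have: #|reach u| <= moore_bound r z k + 1 by rewrite -cardG max_card.
rewrite card_reach size_short_paths /moore_bound.
have ge_level t := moore_level_le u t ge_r ge_z.
case: k k_gt1 => [|[|k']] // _; rewrite !big_ord_recl /bump /= edge_level1 arc_level1.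
have: \sum_(i < k') ((moore_level r z (1 + (1 + i))).1 +
                    (moore_level r z (1 + (1 + i))).2) <=
      \sum_(i < k') (edge_level u (1 + (1 + i)).+1 + arc_level u (1 + (1 + i)).+1).
  by apply: leq_sum => i _; have [] := ge_level (1 + (1 + i)); apply: leq_add.
move: (\sum_(i < k') _) (\sum_(i < k') _) => S S' le_S.
have := sum_paths_ge u 1 ge_r; rewrite -edge_levelS edge_level1 arc_level1.
have := sum_paths_ge u 1 ge_z; rewrite -arc_levelS edge_level1 arc_level1.
have := ge_r u; have := ge_z u; move: (udeg u) (outdeg u) => d d'.
move: (edge_level u 2) (arc_level u 2) => e a.
case: r r_gt0 => // r' _ ? ? ? ?; rewrite subn1 /= => ?; nia.
Qed.

Lemma excess1_missing u :
    (forall x : G, udeg x = r) -> (forall x : G, outdeg x = z) ->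
    #|G| = moore_bound r z k + 1 ->
  #|[predC reach u]| = 1.
Proof.
move=> eq_r eq_z cardG; have := cardC (reach u); rewrite cardG.
rewrite card_reach size_short_paths /moore_bound.
pose width t := (moore_level r z t).1 + (moore_level r z t).2.
rewrite (eq_bigr (fun t : 'I_k => width t)); last first.
  by move=> t _; rewrite /width (moore_level_eq u t eq_r eq_z).
by move/addnI.
Qed.

End Excess.
End Reach.

(** * The balance identity *)

Section Balance.
Variables (G : mixed_graph) (k : nat).
Implicit Types (u v w x y : G) (p q s : seq G).
Hypothesis geoG : geodetic G k.

(** [s] lists the vertices after [u] of a walk from [u] to [v] that is a mixed
path once its first step is removed; for [tail_walk] it is the last step that is
removed. *)
Definition head_walk u v s :=
  if s is w :: p then [&& adj u w, mpath w p & last w p == v] else false.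

Definition tail_walk u v s :=
  let q := behead (belast u s) in
  [&& s != [::], last u s == v, mpath u q & adj (last u q) v].

Lemma tail_walk_rcons u v q x :
  tail_walk u v (rcons q x) = [&& x == v, mpath u q & adj (last u q) v].
Proof.
by rewrite /tail_walk belast_rcons last_rcons -size_eq0 size_rcons.
Qed.

(** The conditions on head walks and tail walks agree except at the two ends, so a
head walk that is not a tail walk must start by traversing an edge back and forth.
The walk that goes along an edge and straight back is of both kinds, whence the
condition [p <> [::]]. *)
Lemma head_walk_only u v s :
  head_walk u v s && ~~ tail_walk u v s <->
  exists w p, [/\ s = [:: w, u & p], p <> [::], last u p = v, edge u w
                & mpath w (u :: p)].
Proof.
split=> [/andP[] | [w [p [-> nz_p def_v euw mp_p]]]]; last first.
  rewrite /head_walk mp_p /= def_v eqxx (edge_adj euw) /=.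
  case/lastP: p nz_p def_v mp_p => // p x _ _ _.
  rewrite -[[:: w, u & _]]/(rcons [:: w, u & p] x) tail_walk_rcons.
  by rewrite (@mpath_cons _ u w) euw eqxx !andbF.
case: s => // w p /= /and3P[auw mp_p /eqP def_v].
case/lastP: p => [|p x] in mp_p def_v *.
  rewrite -[[:: w]]/(rcons [::] w) tail_walk_rcons -[w]/(last w [::]) def_v.
  by rewrite eqxx -def_v auw.
move: mp_p def_v; rewrite last_rcons mpath_rcons => /and3P[mp_p a_x nback] def_v.
rewrite -rcons_cons tail_walk_rcons def_v eqxx /= mpath_cons auw mp_p.
rewrite -{1}def_v a_x andbT.
case: p => // y p in mp_p a_x nback * => /negPn/andP[euw /eqP def_y].
move: mp_p a_x nback; rewrite def_y => mp_p a_x nback.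
exists w, (rcons p x); split; rewrite ?last_rcons ?def_v //; first by case: (p).
by rewrite -rcons_cons mpath_rcons -def_v mp_p a_x.
Qed.

Lemma tail_walk_only u v s :
  tail_walk u v s && ~~ head_walk u v s <->
  exists p y, [/\ s = rcons (rcons p y) v, p <> [::], last u p = v, edge v y
                & mpath u (rcons p y)].
Proof.
split=> [/andP[] | [p [y [-> nz_p def_v evy mp_p]]]]; last first.
  rewrite tail_walk_rcons eqxx last_rcons mp_p edge_adj 1?edge_sym //=.
  case: p nz_p def_v mp_p => // w p _ def_v _.
  rewrite !rcons_cons /= mpath_rcons ends_edge_rcons penult_rcons.
  by rewrite -[last w p]/(last u (w :: p)) def_v evy eqxx !andbF.
case/lastP: s => // q x; rewrite tail_walk_rcons => /and3P[/eqP-> mp_q a_v].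
case: q => [|w q] in mp_q a_v *; first by rewrite /= a_v eqxx.
move: (mp_q); rewrite rcons_cons /= last_rcons eqxx andbT mpath_cons.
case/and3P=> auw mp_wq _; rewrite auw mpath_rcons mp_wq a_v /= => /negPn.
case/lastP: q => [|q y] in mp_q a_v mp_wq *.
  by rewrite /ends_edge /penult /= edge_irr.
rewrite ends_edge_rcons penult_rcons => /andP[evy /eqP def_v].
by exists (w :: q), y; split; rewrite // -def_v.
Qed.

Notation walk := (k.+1.-bseq G).

Definition head_walks u v := [set s : walk | head_walk u v s].
Definition tail_walks u v := [set s : walk | tail_walk u v s].

(** A head walk is determined by its first step and a tail walk by its last one:
the remaining path is short and has known ends. *)
Lemma head_inj u v : {in head_walks u v &, injective (fun s : walk => head u s)}.
Proof.
move=> s t; rewrite !inE => Ls Lt eq_head; apply: val_inj.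
move: (valP s) (valP t) Ls Lt eq_head => /=.
case: (val s) (val t) => // w p [|w' p'] //= le_p le_p' /and3P[_ mp_p /eqP last_p].
case/and3P=> _ mp_p' /eqP last_p' eq_w; move: mp_p' last_p'.
rewrite -eq_w => mp_p' last_p'; congr (_ :: _).
by apply: (short_path_uniq geoG mp_p mp_p'); rewrite // last_p.
Qed.

Lemma penult_inj u v : {in tail_walks u v &, injective (fun s : walk => penult u s)}.
Proof.
move=> s t; rewrite !inE => Rs Rt eq_pen; apply: val_inj.
move: (valP s) (valP t) Rs Rt eq_pen => /=.
case/lastP: (val s) => // p x; case/lastP: (val t) => // q y.
rewrite !size_rcons !tail_walk_rcons !penult_rcons => le_p le_q.
move=> /and3P[/eqP-> mp_p _] /and3P[/eqP-> mp_q _] eq_last.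
by rewrite (short_path_uniq geoG mp_p mp_q).
Qed.

Lemma card_head_walks u v :
  #|head_walks u v| = #|[set w | adj u w && reach k w v]|.
Proof.
rewrite -(card_in_imset (@head_inj u v)); apply: eq_card => w.
rewrite !inE; apply/imsetP/andP => [[[s le_s]] | [auw /reachP[p [mp_p last_p le_p]]]].
  rewrite inE /=; case: s le_s => // w' p le_p /and3P[auw mp_p /eqP last_p] ->.
  by split=> //; apply/reachP; exists p.
have le_s : size (w :: p) <= k.+1 by [].
by exists (Bseq le_s); rewrite // inE /= auw mp_p last_p eqxx.
Qed.

Lemma card_tail_walks u v :
  #|tail_walks u v| = #|[set w | adj w v && reach k u w]|.
Proof.
rewrite -(card_in_imset (@penult_inj u v)); apply: eq_card => w.
rewrite !inE; apply/imsetP/andP => [[[s le_s]] | [awv /reachP[p [mp_p last_p le_p]]]].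
  rewrite inE /=; case/lastP: s le_s => // p x; rewrite size_rcons => le_p.
  rewrite tail_walk_rcons penult_rcons => /and3P[_ mp_p awv] ->.
  by split=> //; apply/reachP; exists p.
have le_s : size (rcons p v) <= k.+1 by rewrite size_rcons.
exists (Bseq le_s); last by rewrite /= penult_rcons.
by rewrite inE tail_walk_rcons eqxx mp_p last_p.
Qed.

Variable r : nat.
Hypothesis deg_r : forall x : G, udeg x = r.

Lemma card_edges_but x y : #|[set w | edge x w && (w != y)]| + edge x y = r.
Proof.
rewrite -(deg_r x) /udeg (cardsD1 y [set w | edge x w]) inE addnC; congr (_ + _).
by apply: eq_card => w; rewrite !inE andbC.
Qed.

(** The detour that starts such a head walk can use any edge at [u] except the one,
if any, with which [p] itself begins. *)
Lemma card_head_only u v p :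
    mpath u p -> last u p = v -> p <> [::] -> size p < k ->
  #|head_walks u v :\: tail_walks u v| + starts_edge u p = r.
Proof.
move=> mp_p last_p nz_p lt_p.
case def_p: p => [|y p'] //; rewrite -(card_edges_but u y); congr (_ + _).
rewrite -(card_in_imset (sub_in2 _ (@head_inj u v))); last first.
  by move=> s; rewrite !inE => /andP[].
apply: eq_card => w; apply/imsetP/idP => [[[s le_s]] | ].
  rewrite !inE andbC => /head_walk_only[w' [q [def_s nz_q last_q euw mp_q]]] ->.
  move: (le_s) mp_q; rewrite /= (def_s : s = _) /= mpath_cons euw.
  move=> le_q /and3P[_ mp_q].
  have -> : q = p.
    by apply: (short_path_uniq geoG mp_q mp_p); rewrite ?last_p //; apply: ltnW.
  by rewrite def_p [edge w' u]edge_sym euw eq_sym.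
rewrite inE => /andP[euw ne_wy].
have le_s : size [:: w, u & p] <= k.+1 by [].
exists (Bseq le_s); rewrite // !inE andbC; apply/head_walk_only; exists w, p.
split; rewrite // mpath_cons mp_p edge_adj 1?edge_sym // def_p eq_sym negb_and.
by rewrite ne_wy orbT.
Qed.

Lemma card_tail_only u v p :
    mpath u p -> last u p = v -> p <> [::] -> size p < k ->
  #|tail_walks u v :\: head_walks u v| + ends_edge u p = r.
Proof.
move=> mp_p last_p nz_p lt_p.
rewrite -(card_edges_but v (penult u p)) /ends_edge edge_sym last_p.
congr (_ + _).
rewrite -(card_in_imset (sub_in2 _ (@penult_inj u v))); last first.
  by move=> s; rewrite !inE => /andP[].
apply: eq_card => w; apply/imsetP/idP => [[[s le_s]] | ].
  rewrite !inE andbC => /tail_walk_only[q [y [def_s nz_q last_q evy mp_q]]] ->.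
  move: (le_s) mp_q; rewrite /= (def_s : s = _) /= penult_rcons !size_rcons last_rcons.
  rewrite mpath_rcons.
  move=> le_q /and3P[mp_q _ ].
  have -> : q = p.
    by apply: (short_path_uniq geoG mp_q mp_p); rewrite ?last_p //; apply: ltnW.
  rewrite evy eq_sym /=; apply: contra => /eqP eq_y.
  by rewrite /ends_edge last_p eq_y eqxx edge_sym -eq_y evy.
rewrite inE => /andP[evw ne_w].
have le_s : size (rcons (rcons p w) v) <= k.+1 by rewrite !size_rcons.
exists (Bseq le_s); last by rewrite /= penult_rcons last_rcons.
rewrite !inE andbC; apply/tail_walk_only; exists p, w; split=> //.
by rewrite mpath_rcons mp_p last_p edge_adj //= eq_sym (negbTE ne_w) andbF.
Qed.

Lemma walks_nopath u v :
    (forall p, mpath u p -> last u p = v -> size p < k -> p = [::]) ->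
  head_walks u v = tail_walks u v.
Proof.
move=> nopath; apply/eqP; rewrite eqEsubset; apply/andP; split; apply/subsetP => s.
  rewrite !inE => Ls; apply: contraT => nRs.
  have /head_walk_only : head_walk u v s && ~~ tail_walk u v s by rewrite Ls.
  case=> w [p [def_s nz_p last_p _]].
  rewrite mpath_cons => /and3P[_ mp_p _]; case: nz_p; apply: nopath => //.
  by have := valP s; rewrite /= def_s.
rewrite !inE => Rs; apply: contraT => nLs.
have /tail_walk_only : tail_walk u v s && ~~ head_walk u v s by rewrite Rs.
case=> p [w [def_s nz_p last_p _]].
rewrite mpath_rcons => /and3P[mp_p _ _]; case: nz_p; apply: nopath => //.
by have := valP s; rewrite /= def_s !size_rcons.
Qed.

Variables (z : nat) (o : G -> G).
Hypothesis outdeg_z : forall x : G, outdeg x = z.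
Hypothesis reachE : forall u v, reach k u v = (v != o u).

(** The first step may go to any out-neighbour of [u] that reaches [v]. *)
Lemma head_walks_outlier u v :
  #|head_walks u v| + #|[set w | adj u w && (o w == v)]| = r + z.
Proof.
rewrite card_head_walks -(deg_r u) -(outdeg_z u) -card_adj.
rewrite -(cardsID [set w | o w == v] [set w | adj u w]) addnC; congr (_ + _).
  by apply: eq_card => w; rewrite !inE.
by apply: eq_card => w; rewrite !inE reachE eq_sym andbC.
Qed.

Lemma tail_walks_outlier u v :
  #|tail_walks u v| + adj (o u) v = r + indeg v.
Proof.
rewrite card_tail_walks -(deg_r v) -card_adj_in [RHS](cardsD1 (o u)) inE addnC.
congr (_ + _).
by apply: eq_card => w; rewrite !inE reachE andbC.
Qed.

(** Compare the numbers of walks of the two kinds: the walks of both kinds cancel,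
and those of only one kind number [r] up to a correction for each kind. *)
Lemma balance u v p :
    mpath u p -> last u p = v -> p <> [::] -> size p < k ->
  z + adj (o u) v + starts_edge u p
  = indeg v + #|[set w | adj u w && (o w == v)]| + ends_edge u p.
Proof.
move=> mp_p last_p nz_p lt_p.
have := card_head_only mp_p last_p nz_p lt_p.
have := card_tail_only mp_p last_p nz_p lt_p.
have := cardsID (tail_walks u v) (head_walks u v).
have := cardsID (head_walks u v) (tail_walks u v); rewrite setIC.
have := head_walks_outlier u v; have := tail_walks_outlier u v.
lia.
Qed.

Lemma balance_nopath u v :
    (forall p, mpath u p -> last u p = v -> size p < k -> p = [::]) ->
  z + adj (o u) v = indeg v + #|[set w | adj u w && (o w == v)]|.
Proof.
move/walks_nopath => eq_walks.
have := head_walks_outlier u v; have := tail_walks_outlier u v.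
rewrite eq_walks; lia.
Qed.

End Balance.

(** * Excess one and geodecity at least three *)

Lemma sum_indeg (G : mixed_graph) : \sum_(v : G) indeg v = \sum_(u : G) outdeg u.
Proof.
rewrite /indeg /outdeg.
under eq_bigr do rewrite -sum1dep_card big_mkcond.
rewrite exchange_big; apply: eq_bigr => u _.
by rewrite -sum1dep_card -big_mkcond.
Qed.

Lemma indeg_eq_of_le (G : mixed_graph) (z : nat) :
    (forall u : G, outdeg u = z) -> (forall v : G, indeg v <= z) ->
  forall v : G, indeg v = z.
Proof.
move=> outdeg_z le_z v.
have := sum_indeg G; under [in X in _ = X -> _]eq_bigr do rewrite outdeg_z.
move=> eq_sum; apply/eqP.
have [_] := leqif_sum (P := predT) (fun x _ => leqif_eq (le_z x)).
by rewrite eq_sum eqxx => /esym/forallP/(_ v).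
Qed.

Section Outlier.
Variables (G : mixed_graph) (k r z : nat) (o : G -> G).
Implicit Types (u v w x y : G) (p q s : seq G).
Hypothesis geoG : geodetic G k.
Hypothesis deg_r : forall x : G, udeg x = r.
Hypothesis outdeg_z : forall x : G, outdeg x = z.
Hypothesis reachE : forall u v, reach k u v = (v != o u).
Hypotheses (r_gt0 : 0 < r) (z_gt0 : 0 < z).

Lemma mpath1 u x : mpath u [:: x] = adj u x.
Proof. by rewrite mpath_cons /= andbT. Qed.

Lemma mpath2 u x y :
  mpath u [:: x; y] = [&& adj u x, adj x y & ~~ (edge u x && (y == u))].
Proof. by rewrite mpath_cons mpath1. Qed.

Lemma mpath3 u x y t :
  mpath u [:: x; y; t]
  = [&& adj u x, adj x y, ~~ (edge u x && (y == u)), adj y t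
      & ~~ (edge x y && (t == x))].
Proof.
rewrite mpath_cons mpath2 -!andbA; congr andb; congr andb.
by rewrite andbA andbC.
Qed.

Lemma not_outlier u p : mpath u p -> size p <= k -> last u p <> o u.
Proof.
move=> mp_p le_p /eqP; apply/negP; rewrite -reachE; apply/reachP.
by exists p.
Qed.

Lemma no_closed u p : mpath u p -> size p <= k -> last u p = u -> p = [::].
Proof. by move=> mp_p le_p last_p; apply: (short_path_uniq geoG (q := [::]) mp_p). Qed.

(** The number of out-neighbours of [u] that miss [v]. *)
Definition hits u v := #|[set w | adj u w && (o w == v)]|.

Lemma hits_gt0 u v : 0 < hits u v -> exists2 w, adj u w & o w = v.
Proof. by case/card_gt0P => w; rewrite inE => /andP[auw /eqP]; exists w. Qed.

Lemma ex_edge u : exists x, edge u x.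
Proof.
have: 0 < udeg u by rewrite deg_r.
by case/card_gt0P => x; rewrite inE; exists x.
Qed.

Lemma ex_arc u : exists x, arc u x.
Proof.
have: 0 < outdeg u by rewrite outdeg_z.
by case/card_gt0P => x; rewrite inE; exists x.
Qed.

(** If [size p = k] then geodecity excludes a path of length below [k] with the
same ends, and if [size p = 0] it excludes a closed one; in both cases there is
no correction. *)
Lemma balance_even u p :
    mpath u p -> size p <= k -> starts_edge u p = ends_edge u p ->
  z + adj (o u) (last u p) = indeg (last u p) + hits u (last u p).
Proof.
move=> mp_p le_p eq_ends; case: (posnP (size p)) => [/size0nil p0 | p_gt0].
  apply: (balance_nopath geoG deg_r outdeg_z reachE) => q mp_q last_q le_q.
  by apply: (no_closed mp_q (ltnW le_q)); rewrite last_q p0.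
have nz_p : p <> [::] by case: (p) p_gt0.
case: (ltnP (size p) k) => [lt_p | ge_p]; last first.
  apply: (balance_nopath geoG deg_r outdeg_z reachE) => q mp_q last_q lt_q.
  have def_q : q = p by apply: (short_path_uniq geoG mp_q mp_p); rewrite // ltnW.
  by rewrite def_q ltnNge ge_p in lt_q.
have := balance geoG deg_r outdeg_z reachE mp_p (erefl _) nz_p lt_p.
by rewrite eq_ends => /addIn.
Qed.

Lemma ends_edge2 u x y : ends_edge u [:: x; y] = edge x y. Proof. by []. Qed.
Lemma ends_edge3 u x y t : ends_edge u [:: x; y; t] = edge y t. Proof. by []. Qed.

Section AtLeastThree.
Hypothesis k_gt2 : 2 < k.
Let k_gt1 : 1 < k := ltnW k_gt2.
Let k_gt0 : 0 < k := ltnW k_gt1.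

Lemma balance_arc_edge u x v :
  arc u x -> edge x v -> z + adj (o u) v = indeg v + hits u v + 1.
Proof.
move=> aux exv.
have mp_p : mpath u [:: x; v].
  by rewrite mpath2 (arc_adj aux) (edge_adj exv) (arc_edgeF aux).
have := balance geoG deg_r outdeg_z reachE mp_p (erefl _) _ k_gt2.
by rewrite ends_edge2 exv /= (arc_edgeF aux) addn0; apply.
Qed.

Lemma balance_edge_arc u x v :
  edge u x -> arc x v -> z + adj (o u) v + 1 = indeg v + hits u v.
Proof.
move=> eux axv.
have ne_vu : v != u.
  by apply: contraTneq eux => <-; rewrite (arc_edgeF' axv).
have mp_p : mpath u [:: x; v].
  by rewrite mpath2 (arc_adj axv) (edge_adj eux) negb_and ne_vu orbT.
have := balance geoG deg_r outdeg_z reachE mp_p (erefl _) _ k_gt2.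
by rewrite ends_edge2 (arc_edgeF axv) addn0 /= eux; apply.
Qed.

(** An arc into [x] followed by the edge to [v] would be a path with a
correction that forces [indeg v <= z]. *)
Lemma surplus_edge_indeg0 v x : z < indeg v -> edge v x -> indeg x = 0.
Proof.
move=> v_surplus evx; apply/eqP; apply: contraLR v_surplus; rewrite -lt0n -leqNgt.
case/card_gt0P => u; rewrite inE => aux.
have := balance_arc_edge aux (_ : edge x v); rewrite edge_sym => /(_ evx).
case: (adj _ _); lia.
Qed.

(** As [x] has no arc coming in, [balance] for the path [[:: x]] says that at
least [z] out-neighbours of [v] miss [x]. The edge-neighbours of [v] all reach
[x], so the vertices that miss it are the [z] heads of arcs out of [v]. *)
Lemma surplus_arc_outlier v x w :
  z < indeg v -> edge v x -> arc v w -> o w = x.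
Proof.
move=> v_surplus evx avw.
have sub : [set w | adj v w && (o w == x)] \subset [set w | arc v w].
  apply/subsetP => y; rewrite !inE => /andP[/orP[evy|//] /eqP oy].
  have [def_y|ne_y] := eqVneq x y.
    by case: (@not_outlier y [::]); rewrite // oy def_y.
  case: (@not_outlier y [:: v; x]); rewrite ?oy // mpath2 !edge_adj // 1?edge_sym //.
  by rewrite negb_and ne_y orbT.
have: [set w | adj v w && (o w == x)] == [set w | arc v w].
  rewrite eqEcard sub [X in X <= _](outdeg_z v) /=.
  have := @balance_even v [:: x]; rewrite mpath1 edge_adj //.
  rewrite (surplus_edge_indeg0 v_surplus) //=.
  rewrite /ends_edge /penult /= evx /hits.
  by move/(_ isT k_gt0 erefl); lia.
by move/eqP/setP/(_ w); rewrite !inE avw => /andP[_ /eqP].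
Qed.

Lemma surplus_edge_uniq v x y :
  z < indeg v -> edge v x -> edge v y -> x = y.
Proof.
have [w avw] := ex_arc v => v_surplus evx evy.
rewrite -(surplus_arc_outlier v_surplus evx avw).
exact: surplus_arc_outlier v_surplus evy avw.
Qed.

(** If [indeg v > z] then [v] has a single edge-neighbour [x], and an arc from
[x] to [y] passes the surplus on to [y]. An edge-neighbour [x'] of [y] then has
in-degree 0 too, and so is missed by some out-neighbour of [v]; but those miss
only [x], and [x] itself reaches [x']. *)
Lemma indeg_le v : indeg v <= z.
Proof.
rewrite leqNgt; apply/negP => v_surplus.
have [x evx] := ex_edge v; have [y axy] := ex_arc x.
have eq_x w : edge v w -> w = x by move=> evw; apply: surplus_edge_uniq v_surplus _ _.
have arc_o w : arc v w -> o w = x by apply: surplus_arc_outlier.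
have y_surplus : z < indeg y.
  suff h0 : hits v y = 0 by have := balance_edge_arc evx axy; lia.
  apply/eqP; rewrite -leqn0 leqNgt; apply/negP => /hits_gt0[w /orP[/eq_x->|/arc_o->]].
    by move=> ox; case: (@not_outlier x [:: y]); rewrite ?mpath1 ?arc_adj.
  by move=> def_y; move: axy; rewrite def_y arc_irr.
have [x' eyx'] := ex_edge y.
have ind0 := surplus_edge_indeg0 y_surplus eyx'.
have mp_p : mpath v [:: x; y; x'].
  rewrite mpath3 (edge_adj evx) (arc_adj axy) (edge_adj eyx') (arc_edgeF axy) /= andbT.
  by apply/negP=> /andP[_ /eqP def_y]; move: evx; rewrite -def_y (arc_edgeF' axy).
have := balance_even mp_p k_gt2; rewrite ends_edge3 eyx' /= evx ind0.
suff ->: hits v x' = 0 by move/(_ erefl); lia.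
apply/eqP; rewrite -leqn0 leqNgt; apply/negP => /hits_gt0[w /orP[/eq_x->|/arc_o->]].
  move=> ox; case: (@not_outlier x [:: y; x']); rewrite // mpath2.
  by rewrite (arc_adj axy) (edge_adj eyx') (arc_edgeF axy).
by move=> def_x; move: eyx'; rewrite -def_x (arc_edgeF' axy).
Qed.

Lemma indeg_regular v : indeg v = z.
Proof. exact: indeg_eq_of_le outdeg_z indeg_le v. Qed.

(** With all in-degrees equal to [z], the correction for this path can only be
compensated by an adjacency from the outlier. *)
Lemma arc_edge_outlier u x v : arc u x -> edge x v -> adj (o u) v.
Proof.
move=> aux exv; have := balance_arc_edge aux exv; rewrite indeg_regular.
by case: (adj _ _) => //; lia.
Qed.

(** Both [v] and [w] would lie between the outlier of an in-neighbour of [x] and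
[x] on paths of length 2. *)
Lemma edge_uniq x v w : edge x v -> edge x w -> v = w.
Proof.
move=> exv exw; have: 0 < indeg x by rewrite indeg_regular.
case/card_gt0P => u; rewrite inE => aux.
have ne_x : x != o u.
  by apply/eqP/(@not_outlier u [:: x]); rewrite ?mpath1 ?arc_adj.
have mp_x y : edge x y -> mpath (o u) [:: y; x].
  move=> exy; rewrite mpath2 (arc_edge_outlier aux exy) edge_adj 1?edge_sym //.
  by rewrite negb_and ne_x orbT.
by have [] := short_path_uniq geoG (mp_x v exv) (mp_x w exw) (erefl _) k_gt1 k_gt1.
Qed.

Definition mate u := odflt u [pick x | edge u x].

Lemma mate_edge u : edge u (mate u).
Proof.
rewrite /mate; case: pickP => //= none.
by have [x] := ex_edge u; rewrite none.
Qed.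

Lemma mateE u x : edge u x -> x = mate u.
Proof. by move=> eux; apply: edge_uniq eux (mate_edge u). Qed.

Lemma mateK : involutive mate.
Proof. by move=> u; apply/esym/mateE; rewrite edge_sym mate_edge. Qed.

(** The mate of [x] cannot be joined to [o u] by an edge: that would give
[o u = x], which [u] reaches. *)
Lemma arc_mate u x : arc u x -> arc (o u) (mate x).
Proof.
move=> aux; have /orP[|//] := arc_edge_outlier aux (mate_edge x).
rewrite edge_sym => /mateE; rewrite mateK => def_x.
by case: (@not_outlier u [:: x]); rewrite ?mpath1 ?arc_adj.
Qed.

Lemma card_out u : #|[set x | arc u x]| = z.
Proof. exact: outdeg_z. Qed.

(** Both sets of arc heads have [z] elements, so the inclusion of [arc_mate] is
an equality. *)
Lemma arc_mateV u y : arc (o u) y -> arc u (mate y).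
Proof.
move=> aoy; suff: y \in mate @: [set x | arc u x].
  by case/imsetP => x; rewrite inE => aux ->; rewrite mateK.
suff /eqP -> : mate @: [set x | arc u x] == [set x | arc (o u) x] by rewrite inE.
rewrite eqEcard card_imset; last exact: inv_inj mateK.
rewrite !card_out leqnn andbT; apply/subsetP => _ /imsetP[x aux ->].
by move: aux; rewrite !inE => /arc_mate.
Qed.

(** If [k >= 4], the path arc, arc, edge from [u] through [x] and [y] is short
enough to have a correction, so [mate y] is an out-neighbour of [o u]. Then
either [o u = y], although [u] reaches [y], or there is an arc from [u] to [y] beside
the path through [x]. *)
Lemma k_eq3 : G -> k = 3.
Proof.
move=> u; apply/eqP; rewrite eqn_leq k_gt2 andbT leqNgt; apply/negP => k_gt3.
have [x aux] := ex_arc u; have [y axy] := ex_arc x.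
have mp_p : mpath u [:: x; y; mate y].
  rewrite mpath3 (arc_adj aux) (arc_adj axy) (edge_adj (mate_edge y)).
  by rewrite (arc_edgeF aux) (arc_edgeF axy).
have mp_q : mpath u [:: x; y] by rewrite mpath2 !arc_adj // (arc_edgeF aux).
have nz_p : [:: x; y; mate y] <> [::] by [].
have := balance geoG deg_r outdeg_z reachE mp_p (erefl _) nz_p k_gt3.
rewrite ends_edge3 mate_edge /= (arc_edgeF aux) indeg_regular.
case: (boolP (adj _ _)) => [/orP[] | _]; last by lia.
  by rewrite edge_sym => /mateE; rewrite mateK => def_o; case: (not_outlier mp_q).
move=> /arc_mateV; rewrite mateK => auy.
have mp_y : mpath u [:: y] by rewrite mpath1 arc_adj.
by have := short_path_uniq geoG mp_q mp_y (erefl _) k_gt1 k_gt0.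
Qed.

(** An arc out of [mate u] extends the edge from [u] to a path of length 2 whose
correction makes its head the outlier of some out-neighbour of [u]. It is not
that of [mate u], so the heads of the arcs out of [mate u] are among the outliers
of the heads of the arcs out of [u]; compare cardinals. *)
Lemma arc_outlier u x : arc u x -> arc (mate u) (o x).
Proof.
move=> aux; have: o x \in o @: [set x | arc u x] by apply: imset_f; rewrite inE.
suff /eqP <- : [set x | arc (mate u) x] == o @: [set x | arc u x] by rewrite inE.
rewrite eqEcard (leq_trans (leq_imset_card _ _)) ?card_out // andbT.
apply/subsetP => y; rewrite inE => amy.
have := balance_edge_arc (mate_edge u) amy; rewrite indeg_regular => eq_h.
have /hits_gt0[w /orP[/mateE->|auw] ow] : 0 < hits u y by lia.
  by case: (@not_outlier (mate u) [:: y]); rewrite ?mpath1 ?arc_adj.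
by apply/imsetP; exists w; rewrite ?inE.
Qed.

(** A last edge into [mate (o u)] would come from [o u]. *)
Lemma outlier_mate_no_edge u p :
  mpath u p -> size p <= k -> last u p = mate (o u) -> ends_edge u p = false.
Proof.
case/lastP: p => [|p x] mp_p le_p; first by rewrite /ends_edge /penult /= edge_irr.
rewrite last_rcons ends_edge_rcons => ->; apply/negP => e.
move: mp_p; rewrite mpath_rcons => /andP[mp_p _].
case: (not_outlier mp_p); first by rewrite size_rcons in le_p; apply: ltnW.
by rewrite edge_sym in e; move: (mateE e); rewrite mateK.
Qed.

(** [mate (o u)] is an out-neighbour of [o u], so by [balance] it is the outlier
of some out-neighbour of [u]. By [arc_outlier], the head of an arc out of [u]
would yield an arc from [mate u] to [mate (o u)], and so a path of length 3 from
[u] to [o u]. *)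
Lemma outlier_mate u : o (mate u) = mate (o u).
Proof.
have adj1 : adj (o u) (mate (o u)) by rewrite edge_adj ?mate_edge.
have : 0 < hits u (mate (o u)).
  pose short p := (last u p == mate (o u)) && (0 < size p < k).
  case: (boolP (has short (short_paths k u))).
    case/hasP => p; rewrite mem_short_paths.
    case/andP=> mp_p le_p /and3P[/eqP last_p p_gt0 lt_p].
    have nz_p : p <> [::] by case: (p) p_gt0.
    have := balance geoG deg_r outdeg_z reachE mp_p last_p nz_p lt_p.
    rewrite adj1 indeg_regular (outlier_mate_no_edge mp_p le_p last_p) /hits; lia.
  move/hasPn => nopath.
  have := balance_nopath geoG deg_r outdeg_z reachE (_ : forall p, _).
  move/(_ u (mate (o u))); rewrite adj1 indeg_regular -/(hits _ _) => eq_h.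
  suff: z + true = z + hits u (mate (o u)) by lia.
  apply: eq_h => p mp_p last_p lt_p; apply/nilP; rewrite /nilp -leqn0 leqNgt.
  have := nopath p; rewrite /short mem_short_paths mp_p (ltnW lt_p) last_p.
  rewrite eqxx lt_p /= andbT.
  exact.
case/hits_gt0 => w /orP[/mateE->|/arc_outlier amo] // ow; rewrite ow in amo.
case: (@not_outlier u [:: mate u; mate (o u); o u]); rewrite //.
rewrite mpath3 (edge_adj (mate_edge u)) (arc_adj amo) (arc_edgeF amo) /= andbT.
rewrite edge_adj 1?edge_sym ?mate_edge // andbT; apply/negP => /andP[_ /eqP def_o].
have: edge (mate u) (mate (o u)) by rewrite def_o edge_sym mate_edge.
by rewrite (arc_edgeF amo).
Qed.

(** A path from [u] to [mate (o u)] has length 3 and ends with an arc, since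
otherwise [u] would reach [o u]; it starts with an arc because [mate u] misses
[mate (o u)]. *)
Lemma geodecity3_impossible : G -> False.
Proof.
move=> u; have k3 := k_eq3 u.
have e_o : edge (mate (o u)) (o u) by rewrite edge_sym mate_edge.
have: reach k u (mate (o u)).
  by rewrite reachE; apply: contraTneq e_o => ->; rewrite edge_irr.
case/reachP=> p [mp_p last_p le_p].
have noedge := outlier_mate_no_edge mp_p le_p last_p.
have sz_p : size p = 3.
  apply/eqP; move: (le_p); rewrite k3 leq_eqVlt => /orP[// | lt_p].
  have: mpath u (rcons p (o u)) by rewrite mpath_rcons mp_p last_p edge_adj // noedge.
  by move/not_outlier; rewrite size_rcons last_rcons k3 => /(_ lt_p).
case: p => [|a [|b [|c []]]] // in mp_p last_p le_p noedge sz_p.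
move: mp_p noedge; rewrite mpath3 ends_edge3 => /and5P[aua aab _ abc _] nbc.
move: last_p => /= def_c; rewrite {}def_c in abc nbc.
have {nbc}abc : arc b (mate (o u)) by case/orP: abc => // e; rewrite e in nbc.
case/orP: aua => [/mateE def_a | aua].
  case: (@not_outlier (mate u) [:: b; mate (o u)]); rewrite ?outlier_mate //.
  rewrite mpath2 -def_a aab (arc_adj abc) /=; apply/negP => /andP[eab /eqP def_o].
  by move: abc; rewrite def_o (edge_arcF' eab).
have ao := arc_mate aua.
(* Middle step an edge: the closed path [o u], [mate a], [mate (o u)], [o u]. *)
case/orP: aab => [/mateE def_b | aab].
  rewrite def_b in abc.
  have := @no_closed (o u) [:: mate a; mate (o u); o u].
  rewrite mpath3 (arc_adj ao) (arc_adj abc) (edge_adj e_o).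
  by rewrite (arc_edgeF ao) (arc_edgeF abc) => /(_ isT k_gt2 erefl).
(* Middle step an arc: the closed path [o u], [mate a], [o b], [o u]. *)
have mo := arc_outlier aab.
have bo := arc_mate abc; rewrite mateK in bo.
have := @no_closed (o u) [:: mate a; o b; o u].
rewrite mpath3 !arc_adj // (arc_edgeF ao) (arc_edgeF mo).
by move=> /(_ isT k_gt2 erefl).
Qed.

End AtLeastThree.
End Outlier.

(** * Excess one and geodecity two *)

Section Two.
Variables (G : mixed_graph) (r z : nat) (o : G -> G).
Implicit Types (u v w x y : G) (p q s : seq G).
Hypothesis geoG : geodetic G 2.
Hypothesis deg_r : forall x : G, udeg x = r.
Hypothesis outdeg_z : forall x : G, outdeg x = z.
Hypothesis reachE : forall u v, reach 2 u v = (v != o u).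
Hypotheses (r_gt0 : 0 < r) (z_gt0 : 0 < z).
Hypothesis cardG : #|G| = moore_bound r z 2 + 1.

Lemma balance2 u v : z + adj (o u) v = indeg v + hits o u v.
Proof.
have even := balance_even geoG deg_r outdeg_z reachE.
have [<-|ne_uv] := eqVneq u v.
  by apply: (even u [::]); rewrite // /ends_edge /penult /= edge_irr.
have [auv|nauv] := boolP (adj u v); first by apply: (even u [:: v]); rewrite ?mpath1.
apply: (balance_nopath geoG deg_r outdeg_z reachE) => -[|x [|y p]] //.
by rewrite mpath1 => aux def_v; rewrite -def_v aux in nauv.
Qed.

Lemma two_step_loop u : #|[set w | adj u w && adj w u]| = r.
Proof.
rewrite -(deg_r u); apply: eq_card => w; rewrite !inE.
apply/andP/idP => [[auw awu] | euw].
  apply: contraT => neuw.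
  have mp_p : mpath u [:: w; u] by rewrite mpath2 auw awu (negbTE neuw).
  by have := no_closed geoG mp_p isT (erefl _).
by rewrite !edge_adj // edge_sym.
Qed.

(** Entry [(u, v)] of the matrix equation [I + A + A^2 + O = J + r I], where [A]
is the adjacency matrix of edges and arcs and [O] the matrix of the map [o]: the
term [r I] stands for the walks that go along an edge and back. *)
Lemma two_step_count u v :
  (u == v) + adj u v + #|[set w | adj u w && adj w v]| + (o u == v)
  = 1 + (u == v) * r.
Proof.
have [<-|ne_uv] := eqVneq u v.
  rewrite two_step_loop adj_irr; case: eqP => [ou|_]; last by lia.
  by case: (not_outlier reachE (_ : mpath u [::]) isT).
have mpE w : mpath u [:: w; v] = adj u w && adj w v.
  by rewrite mpath2 [v == u]eq_sym (negbTE ne_uv) andbF andbT.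
have no_reach : o u = v -> adj u v + #|[set w | adj u w && adj w v]| = 0.
  move=> ou; rewrite eq_card0 => [|w]; last first.
    rewrite !inE -mpE; apply/negP => mp_p.
    by case: (not_outlier reachE mp_p isT).
  case: (boolP (adj u v)) => // auv.
  by case: (not_outlier reachE (_ : mpath u [:: v]) isT); rewrite ?mpath1.
have [/no_reach|ne_o] := eqVneq (o u) v; first by lia.
have: reach 2 u v by rewrite reachE eq_sym.
case/reachP=> p [mp_p last_p le_p].
case: p => [|x [|y [|]]] // in mp_p last_p le_p; rewrite /= in last_p.
- by rewrite last_p eqxx in ne_uv.
- rewrite last_p in mp_p; rewrite -(mpath1 u v) mp_p eq_card0 // => w.
  rewrite !inE -mpE; apply/negP => mp_q.
  by have := short_path_uniq geoG mp_p mp_q (erefl _) isT isT.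
rewrite last_p in mp_p.
have -> : adj u v = false.
  apply/negP; rewrite -(mpath1 u v) => mp_q.
  by have := short_path_uniq geoG mp_p mp_q (erefl _) isT isT.
suff -> : [set w | adj u w && adj w v] = [set x] by rewrite cards1.
apply/setP => w; rewrite !inE -mpE; apply/idP/eqP => [mp_q | -> //].
by have [] := short_path_uniq geoG mp_q mp_p (erefl _) isT isT.
Qed.

Definition misses v := #|[set u | o u == v]|.

Lemma sum_misses : \sum_(v : G) misses v = #|G|.
Proof.
rewrite -sum1_card [RHS](partition_big o predT) //=; apply: eq_bigr => v _.
by rewrite sum1dep_card.
Qed.

Lemma sum_bool_card (P : pred G) : \sum_(u : G) (P u : nat) = #|[set u | P u]|.
Proof. by rewrite -sum1dep_card [RHS]big_mkcond. Qed.

(** The column sums of the equation of [two_step_count]. *)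
Lemma in_count v :
  1 + (r + indeg v) + (r * (r + indeg v) + \sum_(w : G | adj w v) indeg w) + misses v
  = #|G| + r.
Proof.
have card_in w : #|[set x | adj x w]| = r + indeg w by rewrite card_adj_in deg_r.
transitivity (\sum_(u : G) (1 + (u == v) * r)); last first.
  rewrite big_split /= sum1_card (bigD1 v) //= eqxx mul1n big1 ?addn0 // => u.
  by move/negbTE->.
under [RHS]eq_bigr do rewrite -two_step_count.
rewrite !big_split /= !sum_bool_card card_in; congr (_ + _ + _ + _).
  by rewrite -(cards1 v); apply: eq_card => u; rewrite !inE.
under [RHS]eq_bigr do rewrite -sum1dep_card.
rewrite (exchange_big_dep (fun w => adj w v)) /=; last by move=> u w _ /andP[].
transitivity (\sum_(w : G | adj w v) (r + indeg w)).
  rewrite big_split /= sum_nat_cond_const mulnC.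
  by congr (_ * _ + _); rewrite -card_in cardsE.
apply: eq_bigr => w awv; rewrite -card_in -sum1dep_card.
by apply: eq_bigl => u; rewrite awv andbT.
Qed.

Let d := r + z.

(** The Moore bound for [k = 2] is [d^2 + d + 1 - r]. *)
Lemma order2 : #|G| + r = d * d + d + 2.
Proof.
rewrite cardG /moore_bound big_ord_recl big_ord1 /= /d.
case: r r_gt0 => // r' _; lia.
Qed.

Section Surplus.
Variable v0 : G.
Hypothesis v0_surplus : z < indeg v0.

Definition surplus := [set v : G | z < indeg v].

Lemma surplusE v : v \in surplus ->
  [/\ indeg v = z.+1, forall u, adj (o u) v & forall u, hits o u v = 0].
Proof.
rewrite inE => lt_v.
have bal u : [/\ indeg v = z.+1, adj (o u) v & hits o u v = 0].
  by have := balance2 u v; case: (adj _ _) => /=; split; lia.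
by split=> [|u|u]; [case: (bal v) | case: (bal u) | case: (bal u)].
Qed.

(** Each outlier is hit from some vertex, because every vertex [u] is an
out-neighbour of its edge-neighbours. *)
Lemma hits_outlier u : exists w, 0 < hits o w (o u).
Proof.
have [w euw] := ex_edge deg_r r_gt0 u; exists w.
by apply/card_gt0P; exists u; rewrite inE eqxx andbT edge_adj // edge_sym.
Qed.

Lemma misses_surplus v : v \in surplus -> misses v = 0.
Proof.
case/surplusE=> _ _ h0; apply/eqP; rewrite cards_eq0; apply/eqP/setP => u.
rewrite !inE; apply/eqP => ou; have [w] := hits_outlier u.
by rewrite ou h0.
Qed.

Lemma sum_deficit : \sum_(v : G) (z - indeg v) = #|surplus|.
Proof.
suff: \sum_(v : G) indeg v + \sum_(v : G) (z - indeg v) = \sum_(v : G) z + #|surplus|.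
  rewrite sum_indeg (eq_bigr (fun=> z)) => [/addnI // | u _]; exact: outdeg_z.
rewrite -big_split /= -(sum_bool_card (fun v : G => z < indeg v)) -big_split /=.
apply: eq_bigr => v _; case: ltnP => [lt_v | ]; last by lia.
by have /surplusE[-> _ _] : v \in surplus; rewrite ?inE //; lia.
Qed.

Lemma card_in_nbrs v : #|[set w | adj w v]| = r + indeg v.
Proof. by rewrite -(deg_r v) -card_adj_in. Qed.

(** By [in_count] at [v0], the in-degrees of the [d + 1] in-neighbours of [v0]
add up to [d] less than [z * d.+1], while the deficits of all the vertices
add up to the number of surplus vertices. *)
Lemma surplus_large : d <= #|surplus|.
Proof.
have v0S : v0 \in surplus by rewrite inE.
have [ind_v0 _ _] := surplusE v0S.
have := in_count v0; rewrite order2 ind_v0 (misses_surplus v0S).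
have: \sum_(w : G | adj w v0) z <= \sum_(w : G | adj w v0) indeg w + #|surplus|.
  rewrite -sum_deficit [X in _ + X](bigID (fun w => adj w v0)) /= addnA.
  apply: leq_trans (leq_addr _ _); rewrite -big_split /=.
  by apply: leq_sum => w _; lia.
rewrite sum_nat_cond_const card_in_nbrs ind_v0 /d; nia.
Qed.

Lemma outlier_nbrs u v : adj (o u) v = (v \in surplus).
Proof.
suff /eqP/setP/(_ v) -> : surplus == [set v | adj (o u) v] by rewrite inE.
rewrite eqEcard card_adj deg_r outdeg_z surplus_large andbT.
by apply/subsetP => w /surplusE[_ /(_ u)]; rewrite inE.
Qed.

Lemma card_surplus : #|surplus| = d.
Proof.
rewrite /d -(deg_r (o v0)) -(outdeg_z (o v0)) -card_adj.
by apply: eq_card => w; rewrite inE outlier_nbrs.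
Qed.

Lemma hits_deficit u v : v \notin surplus -> z = indeg v + hits o u v.
Proof. by move=> vS; rewrite -balance2 outlier_nbrs (negbTE vS) addn0. Qed.

Lemma outlier_deficit u : indeg (o u) < z.
Proof.
have [w] := hits_outlier u.
have [/surplusE[_ _ ->//] | /(hits_deficit w)] := boolP (o u \in surplus); lia.
Qed.

(** The vertex [a] is an outlier, so its out-neighbours are the surplus
vertices. This makes the in-degree of each of its [r] edge-neighbours [z + 1],
and since [a] has no surplus, no outlier is an in-neighbour of [a]. Insert these
lower bounds into [in_count]. *)
Lemma misses_le a : indeg a < z -> misses a + r <= 1 + d.+1 * (z - indeg a).
Proof.
move=> lt_a.
have aS : a \notin surplus by rewrite inE -leqNgt ltnW.
have from_o b : indeg b < z -> exists u, b = o u.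
  move=> lt_b; have bS : b \notin surplus by rewrite inE -leqNgt ltnW.
  have /hits_gt0[w _ <-] : 0 < hits o b b by have := hits_deficit b bS; lia.
  by exists w.
have ge_z w : adj w a -> z + edge a w <= indeg w.
  move=> awa; case: (boolP (edge a w)) => [eaw | _].
    have [u def_a] := from_o a lt_a.
    have /surplusE[-> _ _] : w \in surplus by rewrite -(outlier_nbrs u) -def_a edge_adj.
    by rewrite addn1.
  rewrite addn0 leqNgt; apply: contra aS => /from_o[u def_w].
  by rewrite -(outlier_nbrs u) -def_w.
have: \sum_(w : G | adj w a) (z + edge a w) <= \sum_(w : G | adj w a) indeg w.
  exact: leq_sum.
rewrite big_split /= sum_nat_cond_const card_in_nbrs.
have -> : \sum_(w : G | adj w a) (edge a w : nat) = r.
  rewrite -(deg_r a) /udeg -sum_bool_card big_mkcond; apply: eq_bigr => w _.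
  by case: ifP => //; case: (boolP (edge a w)) => // e; rewrite edge_adj // edge_sym.
have := in_count a; rewrite order2 /d; move: lt_a.
move: (\sum_(w : G | _) _) (misses a) (indeg a) => S W i lt_i; nia.
Qed.

(** Summed over the outliers, [misses_le] bounds the order by
[d^2 + d + (1 - r) * t], with [t >= 1] the number of vertices of in-degree below
[z]; but the order is [d^2 + d + 2 - r]. *)
Lemma no_surplus2 : False.
Proof.
have: \sum_(a : G | indeg a < z) (misses a + r) <=
      \sum_(a : G | indeg a < z) (1 + d.+1 * (z - indeg a)).
  by apply: leq_sum => a; apply: misses_le.
have sumG : \sum_(a : G | indeg a < z) misses a = #|G|.
  rewrite -sum_misses big_mkcond; apply: eq_bigr => a _; case: ifP => // lt_a.
  apply/esym/eqP; rewrite cards_eq0; apply/eqP/setP => u; rewrite !inE.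
  by apply/eqP => ou; rewrite -ou outlier_deficit in lt_a.
rewrite !big_split /= sumG -big_distrr /= !sum_nat_cond_const.
have -> : \sum_(a : G | indeg a < z) (z - indeg a) = d.
  rewrite -card_surplus -sum_deficit big_mkcond; apply: eq_bigr => a _.
  by case: ltnP => //; lia.
have: 0 < #|[set a : G | indeg a < z]|.
  by apply/card_gt0P; exists (o v0); rewrite inE outlier_deficit.
have := order2; move: #|[set a | _]| => t eq_n t_gt0.
have: r + t <= t * r + 1 by case: (t) t_gt0 (r) r_gt0 => // t' _ [|r'] // _; nia.
rewrite plusE -/d; move: eq_n; move: d #|G| => e n; lia.
Qed.

End Surplus.

Lemma indeg_regular2 v : indeg v = z.
Proof.
apply: indeg_eq_of_le outdeg_z _ v => x.
by rewrite leqNgt; apply/negP => /no_surplus2.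
Qed.

End Two.

(** * The classification *)

Theorem theorem18 (r z k : nat) (G : mixed_graph)
  (hr : 1 <= r) (hz : 1 <= z) (hk : 2 <= k)
  (hG : excess_graph r z k 1 G) :
  k = 2 /\ totally_regular G.
Proof.
case: hG => geoG [ge_r [u0 _]] [ge_z _] cardG.
have degs u := excess1_degrees geoG hr hz hk ge_r ge_z u cardG.
have deg_r (u : G) : udeg u = r by have [] := degs u.
have outdeg_z (u : G) : outdeg u = z by have [] := degs u.
have missing (u : G) := excess1_missing geoG u deg_r outdeg_z cardG.
pose o (u : G) := odflt u [pick v | ~~ reach k u v].
have reachE u v : reach k u v = (v != o u).
  rewrite /o; have /card1P[x def_x] : #|predC (reach k u)| == 1 by rewrite missing.
  have nreach w : ~~ reach k u w = (w == x) := def_x w.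
  case: pickP => [w | /(_ x)]; last by rewrite nreach eqxx.
  by rewrite nreach => /eqP->; apply: negb_inj; rewrite negbK nreach.
have [k_gt2 | k_le2] := ltnP 2 k.
  by case: (geodecity3_impossible geoG deg_r outdeg_z reachE hr hz k_gt2 u0).
have k2 : k = 2 by apply/eqP; rewrite eqn_leq k_le2.
split=> //; exists r, z => u; split=> //; subst k.
exact: (indeg_regular2 geoG deg_r outdeg_z reachE hr).
Qed.
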